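(* Let $\mathbb{F}$ be a field. Suppose that an $n\times m$ matrix $A$ over $\mathbb{F}$ has rank $r>0$, and that $W_{i_{1}}, W_{i_{2}},\ldots,W_{i_{r}}$ is the lime basis of the column space of $A$, where $i_1<i_2<\cdots<i_r$ are the lime indices of the column space of $A$. Let $B$ be the matrix whose columns are $W_{i_{1}}, W_{i_{2}},\ldots,W_{i_{r}}$, and let $G$ be the matrix whose rows are the rows $R_{i_{1}}, R_{i_{2}},\ldots,R_{i_{r}}$ of $A$ (where $R_i$ denotes the $i$-th row of $A$). Then $$A=BG\quad\text{and}\quad \mathrm{Rank}(B)=r=\mathrm{Rank}(G).$$
   Context: $\mathbb{F}$ is an arbitrary field. A non-zero vector in $\mathbb{F}^n$ originates in the $j$-th position if its first non-zero entry is in the $j$-th position. For a subspace $\mathcal{W}$ of $\mathbb{F}^n$, an index $j$ is a lime index of $\mathcal{W}$ (and the $j$-th position is a lime position) if $\mathcal{W}$ contains an element that originates in the $j$-th position. For each lime index $i$ of $\mathcal{W}$, the lime-basic element $W_i$ is the (unique, existing) element of $\mathcal{W}$ that originates with a $1$ in the $i$-th position and has $0$'s in all lime positions of $\mathcal{W}$ following the $i$-th. The lime basis of $\mathcal{W}$ is the basis of $\mathcal{W}$ formed by its lime-basic elements, listed in increasing order of the corresponding lime indices. The column space of an $n\times m$ matrix is the span of its columns in $\mathbb{F}^n$; the rank is the common value of the dimensions of the column space and of the row space. *)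

(* Defs.v *)
From HB Require Import structures.
From mathcomp Require Import all_boot all_order all_algebra.

Set Implicit Arguments.
Unset Strict Implicit.
Unset Printing Implicit Defensive.

Import GRing.Theory.
Local Open Scope ring_scope.

(* Elements of F^n are column vectors; positions are numbered
   from 0. *)

Definition originates (F : fieldType) (n : nat) (v : 'cV[F]_n) (j : 'I_n) : Prop :=
  v j 0 != 0 /\ forall k : 'I_n, (k < j)%N -> v k 0 = 0.

Definition lime_index (F : fieldType) (n : nat) (W : {vspace 'cV[F]_n})
    (j : 'I_n) : Prop :=
  exists2 v : 'cV[F]_n, v \in W & originates v j.

Definition lime_basic (F : fieldType) (n : nat) (W : {vspace 'cV[F]_n})
    (i : 'I_n) (w : 'cV[F]_n) : Prop :=
  [/\ w \in W, originates w i, w i 0 = 1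
    & forall j : 'I_n, (i < j)%N -> lime_index W j -> w j 0 = 0].

Definition lime_indices (F : fieldType) (n r : nat) (W : {vspace 'cV[F]_n})
    (idx : 'I_r -> 'I_n) : Prop :=
  (forall a b : 'I_r, (a < b)%N -> (idx a < idx b)%N) /\
  (forall j : 'I_n, lime_index W j <-> exists a : 'I_r, idx a = j).

(* The family w lists the lime-basic elements of W along the increasing
   enumeration idx of all the lime indices. That such a family is a basis of W
   is a consequence, so it is not required here. *)
Definition lime_basis (F : fieldType) (n r : nat) (W : {vspace 'cV[F]_n})
    (idx : 'I_r -> 'I_n) (w : 'I_r -> 'cV[F]_n) : Prop :=
  lime_indices W idx /\ forall a : 'I_r, lime_basic W (idx a) (w a).

Definition column_space (F : fieldType) (n m : nat) (A : 'M[F]_(n, m)) :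
    {vspace 'cV[F]_n} :=
  <<[seq col j A | j <- enum 'I_m]>>%VS.

(* Main.v *)
Require Import Defs.
From HB Require Import structures.
From mathcomp Require Import all_boot all_order all_algebra.

Set Implicit Arguments.
Unset Strict Implicit.
Unset Printing Implicit Defensive.

Import GRing.Theory.
Local Open Scope ring_scope.

(** A vector of a subspace is determined by its entries in the lime positions:
    the difference of two vectors agreeing there lies in the subspace, and if
    it were non-zero it would originate in a lime position, where it is zero
    ([lime_index_entries_eq0]).  Restricted to the lime positions, the
    lime-basic elements form an identity matrix ([lime_basis_entry]), so the
    coordinates of a vector on the lime basis are simply its own entries in the
    lime positions ([lime_basis_expansion]).  For the columns of [A], those
    entries are the columns of [G], whence [A = B *m G].  The inner dimension
    of this factorization is already the rank of [A], which squeezes the ranks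
    of both factors. *)

Lemma nonzero_originates (F : fieldType) (n : nat) (v : 'cV[F]_n) :
  v != 0 -> exists j, originates v j.
Proof.
case/cV0Pn=> i vi_neq0.
case: (@arg_minnP _ i (fun j => v j 0 != 0) (@nat_of_ord n) vi_neq0) => j vj minj.
exists j; split=> // k ltkj; apply/eqP/negPn/negP=> /minj.
by rewrite leqNgt ltkj.
Qed.

Lemma lime_index_entries_eq0 (F : fieldType) (n : nat)
    (W : {vspace 'cV[F]_n}) (v : 'cV[F]_n) :
  v \in W -> (forall j, lime_index W j -> v j 0 = 0) -> v = 0.
Proof.
move=> vW v0; apply/eqP/negPn/negP=> /nonzero_originates [j vj].
have := v0 j (ex_intro2 _ _ v vW vj).
by case: vj => /eqP.
Qed.

(** The entries before the leading [1] vanish by origination, those after it by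
    reducedness. *)
Lemma lime_basis_entry (F : fieldType) (n r : nat) (W : {vspace 'cV[F]_n})
    (idx : 'I_r -> 'I_n) (w : 'I_r -> 'cV[F]_n) (a b : 'I_r) :
  lime_basis W idx w -> w a (idx b) 0 = (a == b)%:R.
Proof.
move=> [[idx_mono idxP] /(_ a) [_ [_ w_before] w_lead w_after]].
case: (ltngtP a b) => [ltab | ltba | /val_inj <-].
- rewrite w_after ?idx_mono //; last by apply/idxP; exists b.
  by rewrite -val_eqE ltn_eqF.
- by rewrite w_before ?idx_mono // -val_eqE gtn_eqF.
- by rewrite eqxx.
Qed.

Lemma lime_basis_expansion (F : fieldType) (n r : nat) (W : {vspace 'cV[F]_n})
    (idx : 'I_r -> 'I_n) (w : 'I_r -> 'cV[F]_n) (v : 'cV[F]_n) :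
  lime_basis W idx w -> v \in W -> v = \sum_a v (idx a) 0 *: w a.
Proof.
move=> limew vW; have [[_ idxP] basicw] := limew.
apply/eqP; rewrite -subr_eq0; apply/eqP.
apply: (@lime_index_entries_eq0 _ _ W) => [|j /idxP [b <-]].
  by rewrite memvB // memv_suml // => a _; rewrite memvZ //; case: (basicw a).
rewrite !mxE summxE (bigD1 b) //= big1 => [|a /negPf neq_ab].
  by rewrite mxE (lime_basis_entry _ _ limew) eqxx mulr1 addr0 subrr.
by rewrite mxE (lime_basis_entry _ _ limew) neq_ab mulr0.
Qed.

Lemma col_column_space (F : fieldType) (n m : nat) (A : 'M[F]_(n, m))
    (q : 'I_m) : col q A \in column_space A.
Proof. by apply/memv_span/map_f; rewrite mem_enum. Qed.

Lemma rank_factors (F : fieldType) (n m r : nat) (B : 'M[F]_(n, r))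
    (G : 'M[F]_(r, m)) :
  \rank (B *m G) = r -> \rank B = r /\ \rank G = r.
Proof.
move=> rankBG; split; apply/eqP; rewrite eqn_leq.
  by rewrite rank_leq_col -{1}rankBG mxrankM_maxl.
by rewrite rank_leq_row -{1}rankBG mxrankM_maxr.
Qed.

Theorem theorem7p1 (F : fieldType) (n m r : nat) (A : 'M[F]_(n, m))
    (idx : 'I_r -> 'I_n) (W : 'I_r -> 'cV[F]_n)
    (r_gt0 : (0 < r)%N) (rankA : \rank A = r)
    (limeW : lime_basis (column_space A) idx W) :
  let B : 'M[F]_(n, r) := \matrix_(p < n, k < r) W k p 0 in
  let G : 'M[F]_(r, m) := \matrix_(k < r, q < m) A (idx k) q in
  [/\ A = B *m G, \rank B = r & r = \rank G].
Proof.
move=> B G.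
have defA : A = B *m G.
  apply/matrixP=> p q.
  have /matrixP/(_ p 0) := lime_basis_expansion limeW (col_column_space A q).
  rewrite !mxE summxE => ->; apply: eq_bigr => a _.
  by rewrite !mxE mulrC.
by have [|rankB rankG] := @rank_factors _ _ _ _ B G; rewrite -?defA.
Qed.
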